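(* Let $r$ be a strictly positive real number and let $P=\sum_{i=0}^k a_ix^i\in\mathbb Z[x]^+$ with $k\ge1$ and all $a_i\ne0$. (So $a_0$ and $a_k$ are the coefficients of the least and greatest degree terms in $P$.) Let $R_r=\mathbb Z[\{r^i/P(r)\}_{i\in\mathrm{Log}\,P}]\subset\mathbb R$. Then the following are equivalent: (i) $\tau_r(I)=\tau_r(R_P)$ for every nonzero order ideal $I$ of $R_P$; (ii) there exist nonnegative integers $s$ and $t$ such that both $a_k^s r$ and $a_0^t/r$ are algebraic integers; (iii) $R_r=\mathbb Z[r^{\pm1},P(r)^{\pm1}]$; (iv) for all $j\in\mathrm{Log}\,P$, $P(r)/r^j\in R_r$.
   Context: $\mathbb Z[x]^+$ denotes polynomials with nonnegative integer coefficients; $\mathrm{Log}\,P$ is the set of exponents occurring in $P$ with nonzero coefficient (here $\{0,1,\dots,k\}$). $R_P=\mathbb Z[\{x^i/P\}_{i\in\mathrm{Log}\,P}]$ (a subring of $\mathbb Q(x)$), partially ordered by the cone generated additively and multiplicatively by $\{x^i/P:i\in\mathrm{Log}\,P\}$; it is an ordered ring with $1$ as order unit and a dimension group. An order ideal is a convex directed subgroup. $\tau_r:R_P\to\mathbb R$ is evaluation at $r$: $\tau_r(g/P^n)=g(r)/P(r)^n$. *)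

(* Defs.v *)
From mathcomp Require Import all_boot all_order all_algebra.
From mathcomp Require Import all_classical reals.

Set Implicit Arguments.
Unset Strict Implicit.
Unset Printing Implicit Defensive.

Import Order.TTheory GRing.Theory Num.Theory.
Local Open Scope classical_set_scope.
Local Open Scope ring_scope.

(* The field Q(x), as the fraction field of Z[x]. *)
Notation ratfun := {fraction {poly int}}.

Local Notation "x %:F" := (tofrac x) : ring_scope.

(* Z[S], the subring generated by S. *)
Definition subring_gen (K : nzRingType) (S : set K) : set K :=
  smallest [set A | GRing.subring_closed [in A]] S.

(* Nonempty finite sums of nonempty finite products of elements of S,
   together with 0. *)
Definition cone_gen (K : nzRingType) (S : set K) : set K :=
  smallest [set A | GRing.nmod_closed [in A] /\ GRing.mulr_2closed [in A]] S.

Definition Log (P : {poly int}) : set nat := [set i | P`_i != 0].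

Definition RP_gens (P : {poly int}) : set ratfun :=
  [set ('X^i)%:F / P%:F | i in Log P].

Definition RP (P : {poly int}) : set ratfun := subring_gen (RP_gens P).

Definition RP_pos (P : {poly int}) : set ratfun := cone_gen (RP_gens P).

Definition RP_le (P : {poly int}) (f g : ratfun) : Prop := RP_pos P (g - f).

Definition convex_in_RP (P : {poly int}) (I : set ratfun) : Prop :=
  forall f g h, I f -> I h -> RP P g -> RP_le P f g -> RP_le P g h -> I g.

Definition directed_RP (P : {poly int}) (I : set ratfun) : Prop :=
  forall f g, I f -> I g -> exists h, [/\ I h, RP_le P f h & RP_le P g h].

Definition order_ideal (P : {poly int}) (I : set ratfun) : Prop :=
  [/\ I `<=` RP P, GRing.zmod_closed [in I], convex_in_RP P I
    & directed_RP P I].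

Definition evalZ (R : realType) (r : R) (g : {poly int}) : R :=
  (map_poly intr g).[r].

(* Evaluation cannot be read off the canonical representative of a class in
   ratfun, which need not be reduced and whose denominator may vanish at r;
   hence the choice of a presentation g / P^n. By tauE below the value does
   not depend on it, and by RP_frac every element of RP P has one. *)
Definition tau (R : realType) (P : {poly int}) (r : R) (f : ratfun) : R :=
  xget 0 [set y | exists g n,
    f = g%:F / P%:F ^+ n /\ y = evalZ r g / evalZ r P ^+ n].

Lemma tauE (R : realType) (P : {poly int}) (r : R) (g : {poly int}) n :
  evalZ r P != 0 ->
  tau P r (g%:F / P%:F ^+ n) = evalZ r g / evalZ r P ^+ n.
Proof.
move=> Pr0; apply: xget_unique; first by exists g, n.
have P0 : P != 0.
  by apply: contra_neq Pr0 => ->; rewrite /evalZ rmorph0 horner0.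
have PF0 : P%:F != 0 :> ratfun by rewrite tofrac_eq0.
move=> y [h [m [/eqP]]]; rewrite eqr_div ?expf_neq0 //.
rewrite -!tofracXn -!tofracM tofrac_eq => /eqP gh ->.
apply/eqP; rewrite eqr_div ?expf_neq0 //.
have := congr1 (evalZ r) gh.
by rewrite /evalZ !rmorphM !rmorphXn /= !hornerM !horner_exp => ->.
Qed.

Lemma RP_frac (P : {poly int}) (f : ratfun) :
  P != 0 -> RP P f -> exists g n, f = g%:F / P%:F ^+ n.
Proof.
move=> P0; have PF0 n : P%:F ^+ n != 0 :> ratfun.
  by rewrite expf_neq0 // tofrac_eq0.
apply: (_ : RP P `<=` [set f | exists g n, f = g%:F / P%:F ^+ n]).
apply: smallest_sub => /=; last first.
  by move=> _ [i _ <-]; exists 'X^i, 1%N; rewrite expr1.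
split; first by rewrite !inE; exists 1, 0%N; rewrite expr0 divr1 tofrac1.
- move=> u v; rewrite !inE => -[g [n ->]] [h [m ->]].
  exists (g * P ^+ m - h * P ^+ n), (n + m)%N.
  by rewrite -mulNr addf_div // tofracB !tofracM !tofracXn exprD mulNr.
- move=> u v; rewrite !inE => -[g [n ->]] [h [m ->]].
  exists (g * h), (n + m)%N.
  by rewrite mulf_div tofracM exprD.
Qed.

(* Z[{r^i / P(r)}_{i in Log P}] *)
Definition Rr (R : realType) (P : {poly int}) (r : R) : set R :=
  subring_gen [set r ^+ i / evalZ r P | i in Log P].

Definition algebraic_integer (R : realType) (y : R) : Prop :=
  integralOver (intr : int -> R) y.

(* Main.v *)
(* (i) => (ii): the ideal generated by 1/P contains some f = g/P^n with
   tau f = 1, and positivity forces deg g <= k (n - 1); so r is a root of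
   P^n - g, whose leading coefficient is a_k^n. The ideal generated by x^k/P
   gives the same for 1/r.
   (ii) => (iii): 1 lies in the radical of the ideal of R_r generated by
   1/P(r), so 1/P(r) is a unit of R_r; by the symmetry r <-> 1/r, so is
   r^k/P(r).
   (iv) => (i): an order ideal is an ideal, and a nonzero one contains a product
   of generators x^i/P, whose image under tau is a unit of R_r. *)

From HB Require Import structures.
Require Import Defs.
From mathcomp Require Import all_boot all_order all_algebra.
From mathcomp Require Import all_classical reals.

Set Implicit Arguments.
Unset Strict Implicit.
Unset Printing Implicit Defensive.

Import Order.TTheory GRing.Theory Num.Theory.
Local Open Scope classical_set_scope.
Local Open Scope ring_scope.

Local Notation "x %:F" := (tofrac x) : ring_scope.

(** * Integrality over Z from a polynomial relation *)

Lemma integral_lead_coef (K : fieldType) (b : nat -> int) (N : nat) (y : K) :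
  \sum_(i < N.+1) (b i)%:~R * y ^+ i = 0 ->
  integralOver (intr : int -> K) ((b N)%:~R * y).
Proof.
case: N => [|N] by0.
  (* In degree 0 the relation itself says that [b 0] is 0 in [K]. *)
  move: by0; rewrite big_ord1 expr0 mulr1 => ->; rewrite mul0r.
  exact: integral0.
(* The degree is now [N.+1]. Multiplying the relation by [c ^+ N] makes it monic in [c * y]; [q]
   holds the lower terms, scaled so that q(c y) is [c ^+ N] times the lower part of the relation. *)
pose c := b N.+1.
pose q : {poly int} := \poly_(i < N.+1) (b i * c ^+ (N - i)).
have size_q : (size q < size ('X^(N.+1) : {poly int}))%N.
  by rewrite size_polyXn ltnS size_poly.
exists ('X^(N.+1) + q); first by rewrite monicE lead_coefDl // lead_coefXn.
rewrite /root rmorphD /= map_polyXn hornerD hornerXn.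
rewrite (horner_coef_wide (n := N.+1)); last first.
  exact: leq_trans (size_poly _ _) (size_poly _ _).
rewrite (_ : \sum_(i < _) _ =
  c%:~R ^+ N * \sum_(i < N.+1) (b i)%:~R * y ^+ i); last first.
  rewrite mulr_sumr; apply: eq_bigr => i _.
  rewrite coef_map coef_poly ltn_ord /= intrM rmorphXn /= exprMn.
  have -> : c%:~R ^+ N = c%:~R ^+ (N - i) * c%:~R ^+ i :> K.
    by rewrite -exprD subnK // -ltnS.
  by rewrite [RHS]mulrACA [in RHS](mulrC _ (b i)%:~R).
move: by0; rewrite big_ord_recr /= => /eqP; rewrite addr_eq0 => /eqP ->.
rewrite mulrN mulrA (mulrC (c%:~R ^+ N)) -exprS exprMn.
by rewrite subrr.
Qed.

(** * Radical of a principal ideal, and a criterion for inverting 1/p *)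

Section PowerDivisibility.
Variables (K : comNzRingType) (V : subringClosed K) (c : K).

(* If c^-1 lies in V, this is the radical of the ideal c^-1 V of V. *)
Definition power_mul_in (x : K) := x \in V /\ exists n, x ^+ n * c \in V.

Lemma power_mul_inX n x : x \in V -> power_mul_in (x ^+ n) -> power_mul_in x.
Proof.
by move=> xV [_ [m]]; rewrite -exprM => xc; split=> //; exists (n * m)%N.
Qed.

Lemma power_mul_inM y x : y \in V -> power_mul_in x -> power_mul_in (y * x).
Proof.
move=> yV [xV [n xnc]]; split; first exact: rpredM.
by exists n; rewrite exprMn -mulrA rpredM // rpredX.
Qed.

(** In the binomial expansion of [(x + y) ^+ (n + m)] every term has exponent at least [m] in [y] or
    at least [n] in [x]. *)
Lemma power_mul_inD x y :
  power_mul_in x -> power_mul_in y -> power_mul_in (x + y).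
Proof.
move=> [xV [n xnc]] [yV [m ymc]]; split; first exact: rpredD.
exists (n + m)%N; rewrite exprDn mulr_suml rpred_sum // => i _.
rewrite mulrnAl rpredMn //.
have [mi|/ltnW im] := leqP m i.
  have -> : y ^+ i = y ^+ (i - m) * y ^+ m by rewrite -exprD subnK.
  by rewrite -!mulrA 2?rpredM ?rpredX.
have -> : x ^+ (n + m - i) = x ^+ (m - i) * x ^+ n.
  by rewrite -exprD [in RHS]addnC -addnBA.
by rewrite mulrAC -(mulrA (x ^+ _)) rpredM ?rpredX // rpredM ?rpredX.
Qed.

Lemma power_mul_in_sum (I : Type) (s : seq I) (Q : pred I) (F : I -> K) :
  (forall i, Q i -> power_mul_in (F i)) ->
  power_mul_in (\sum_(i <- s | Q i) F i).
Proof.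
move=> HF; apply: big_ind => //; last exact: power_mul_inD.
by split; [exact: rpred0 | exists 1%N; rewrite mul0r rpred0].
Qed.

End PowerDivisibility.

(* Write u_i = r^i / p. If i < k then u_i^k = u_0^(k-i) u_k^i is in the ideal
   p^-1 V; and multiplying the integrality equation of a_k^s r, of
   degree d, by a_k^d u_k^(s d) u_(k-1)^d puts (a_k u_k)^((s+1) d) in
   u_(k-1) V. So the radical of p^-1 V contains 1 = \sum_i a_i u_i. *)
Lemma integral_inv_mem (K : fieldType) (V : subringClosed K) (a : nat -> int)
    (r p : K) (k s : nat) :
  (0 < k)%N -> p != 0 -> p = \sum_(i < k.+1) (a i)%:~R * r ^+ i ->
  (forall i, (i <= k)%N -> r ^+ i / p \in V) ->
  integralOver (intr : int -> K) ((a k)%:~R ^+ s * r) ->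
  p \in V.
Proof.
move=> k_gt0 p0 p_def uV [q q_mon q_root].
pose u i := r ^+ i / p; pose D := @power_mul_in K V p.
have Du i : (i < k)%N -> D (u i).
  move=> ik; split; first exact/uV/ltnW.
  (* The factor [p] cancels one [u 0 = p^-1], hence the exponent [k - i.+1]. *)
  exists k; suff -> : u i ^+ k * p = u k ^+ i * u 0%N ^+ (k - i.+1).
    by rewrite rpredM ?rpredX ?uV.
  rewrite /u expr0 mul1r !exprMn -!exprM mulnC -!mulrA; congr (_ * _).
  by rewrite -exprD -{1}(subnKC ik) addSn exprSr divfK.
have uk : u k = r * u k.-1 by rewrite /u mulrA -exprS prednK.
have uE i : u i = r ^+ i / p by [].
pose A : K := (a k)%:~R; have AV : A \in V by apply: rpred_int.
have {}uV i : (i <= k)%N -> u i \in V by exact: uV.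
clearbody u.
have [d size_q] : exists d, size q = d.+1.
  by exists (size q).-1; rewrite prednK // size_poly_gt0 monic_neq0.
have q_d : q`_d = 1 by move/monicP: q_mon; rewrite /lead_coef size_q.
have q_eq : (A ^+ s * r) ^+ d =
    \sum_(i < d) - ((q`_i)%:~R * (A ^+ s * r) ^+ i).
  rewrite sumrN; apply/eqP; rewrite -addr_eq0 addrC; apply/eqP.
  move/rootP: q_root; rewrite (horner_coef_wide (n := d.+1)); last first.
    by rewrite -size_q size_poly.
  rewrite big_ord_recr /= coef_map /= q_d mul1r => q0.
  rewrite -[RHS]q0; congr (_ + _).
  by apply: eq_bigr => i _; rewrite coef_map.
have DAuk : D (A * u k).
  apply: (@power_mul_inX _ V p (s.+1 * d)); first by rewrite rpredM ?uV.
  have -> : (A * u k) ^+ (s.+1 * d) =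
      A ^+ d * u k ^+ (s * d) * u k.-1 ^+ d * (A ^+ s * r) ^+ d.
    have ukd : u k ^+ d = r ^+ d * u k.-1 ^+ d by rewrite uk exprMn.
    rewrite mulSn exprD !exprMn ukd -exprM !mulrA.
    by rewrite [LHS](ACl (1*5*3*4*2))%AC.
  rewrite q_eq mulr_sumr; apply: power_mul_in_sum => i _.
  have -> : A ^+ d * u k ^+ (s * d) * u k.-1 ^+ d *
      - ((q`_i)%:~R * (A ^+ s * r) ^+ i) =
      - (q`_i)%:~R * A ^+ d * u k ^+ (s * d) * A ^+ (s * i) * u k ^+ i
        * u k.-1 ^+ (d - i.+1) * u k.-1.
    rewrite -[RHS]mulrA -exprSr subnSK //.
    have -> : u k ^+ i = r ^+ i * u k.-1 ^+ i by rewrite uk exprMn.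
    have -> : u k.-1 ^+ d = u k.-1 ^+ i * u k.-1 ^+ (d - i).
      by rewrite -exprD subnKC // ltnW.
    rewrite exprMn -exprM mulrN !mulNr; congr (- _).
    by rewrite !mulrA [LHS](ACl (5*1*2*6*7*3*4))%AC.
  apply: power_mul_inM; last by apply: Du; rewrite prednK.
  by rewrite !(rpredM, rpredN, rpredX, rpred_int, uV) // leq_pred.
have D1 : D 1.
  have -> : 1 = \sum_(i < k) (a i)%:~R * u i + A * u k.
    transitivity (p / p); first by rewrite divff.
    rewrite {1}p_def big_ord_recr /= mulrDl mulr_suml -mulrA.
    by rewrite uE; congr (_ + _); apply: eq_bigr => i _; rewrite uE mulrA.
  apply: power_mul_inD DAuk; apply: power_mul_in_sum => i _.
  by apply: power_mul_inM; [exact: rpred_int | exact: Du].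
by case: D1 => _ [n]; rewrite expr1n mul1r.
Qed.

(** * Generated subrings and cones *)

Section GeneratedSubsets.
Variables (K : nzRingType) (S : set K).

(** Packages the generated subring as a [subringClosed] predicate, so that the [rpred] lemmas apply
    to it. *)
Lemma subring_gen_subringClosed :
  exists V : subringClosed K, forall x, x \in V <-> subring_gen S x.
Proof.
have closed : GRing.subring_closed [in subring_gen S].
  split=> [|u v|u v].
  - by apply: mem_set => A [[A1 _ _] _]; exact: set_mem.
  - move=> /set_mem Hu /set_mem Hv; apply: mem_set => A HA.
    by apply: set_mem; case: (HA) => [[_ AB _] _]; apply: AB; apply: mem_set;
      [exact: Hu | exact: Hv].
  - move=> /set_mem Hu /set_mem Hv; apply: mem_set => A HA.
    by apply: set_mem; case: (HA) => [[_ _ AM] _]; apply: AM; apply: mem_set;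
      [exact: Hu | exact: Hv].
exists (HB.pack_for (subringClosed K) ([in subring_gen S] : {pred K})
  (GRing.isSubringClosed.Build K _ closed)) => x.
by rewrite -[subring_gen S x]in_setE.
Qed.

Lemma subring_gen_ind (V : subringClosed K) :
  (forall x, S x -> x \in V) -> forall x, subring_gen S x -> x \in V.
Proof.
move=> SV x /(_ [set` V]); apply; split=> //; split=> [|u v|u v].
- exact/mem_set/rpred1.
- by move=> /set_mem /= uV /set_mem /= vV; exact/mem_set/rpredB.
- by move=> /set_mem /= uV /set_mem /= vV; exact/mem_set/rpredM.
Qed.

(** Sums and products stay in the cone by construction, but only nonempty products are formed, so 1
    has to be supplied. *)
Lemma cone_gen_semiringClosed : cone_gen S 1 ->
  exists V : semiringClosed K, forall x, x \in V <-> cone_gen S x.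
Proof.
move=> gen1; have closed : GRing.semiring_closed [in cone_gen S].
  split; split=> [|u v].
  - by apply: mem_set => A [[[A0 _] _] _]; exact: set_mem.
  - move=> /set_mem Hu /set_mem Hv; apply: mem_set => A HA.
    by apply: set_mem; case: (HA) => [[[_ AD] _] _]; apply: AD; apply: mem_set;
      [exact: Hu | exact: Hv].
  - exact: mem_set.
  - move=> /set_mem Hu /set_mem Hv; apply: mem_set => A HA.
    by apply: set_mem; case: (HA) => [[_ AM] _]; apply: AM; apply: mem_set;
      [exact: Hu | exact: Hv].
exists (HB.pack_for (semiringClosed K) ([in cone_gen S] : {pred K})
  (GRing.isSemiringClosed.Build K _ closed)) => x.
by rewrite -[cone_gen S x]in_setE.
Qed.

Lemma cone_gen_ind (Q : K -> Prop) : (forall x, S x -> Q x) -> Q 0 ->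
  (forall x y, Q x -> Q y -> Q (x + y)) ->
  (forall x y, Q x -> Q y -> Q (x * y)) -> forall x, cone_gen S x -> Q x.
Proof.
move=> SQ Q0 QD QM x /(_ Q); apply; do !split=> //.
- exact: mem_set.
- by move=> u v /set_mem uQ /set_mem vQ; exact/mem_set/QD.
- by move=> u v /set_mem uQ /set_mem vQ; exact/mem_set/QM.
Qed.

End GeneratedSubsets.

Lemma coefM_ge0 (R : numDomainType) (p q : {poly R}) :
  (forall i, 0 <= p`_i) -> (forall i, 0 <= q`_i) -> forall i, 0 <= (p * q)`_i.
Proof.
by move=> p0 q0 i; rewrite coefM sumr_ge0 // => j _; exact: mulr_ge0.
Qed.

(** * The ordered ring R_P and its positive cone *)

Section OrderedRing.
Variables (P : {poly int}) (k : nat).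
Hypothesis size_P : size P = k.+1.
Hypothesis P_nneg : P \is a polyOver Num.nneg.
Hypothesis P_coef : forall i, (i <= k)%N -> P`_i != 0.

Local Notation gen i := (('X^i)%:F / P%:F : ratfun).

Lemma LogE i : Log P i <-> (i <= k)%N.
Proof.
split=> [|/P_coef//]; apply: contraPT; rewrite -ltnNge => ki.
by rewrite /Log /= nth_default ?size_P// eqxx.
Qed.

Lemma P_neq0 : P != 0. Proof. by rewrite -size_poly_eq0 size_P. Qed.

Lemma size_PX n : size (P ^+ n) = (k * n).+1.
Proof.
elim: n => [|n IH]; first by rewrite expr0 size_poly1 muln0.
by rewrite exprS size_mul ?expf_neq0 ?P_neq0 // IH size_P addSn addnS mulnS.
Qed.

Lemma PF_neq0 : P%:F != 0 :> ratfun. Proof. by rewrite tofrac_eq0 P_neq0. Qed.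

Lemma coefP_ge0 i : 0 <= P`_i.
Proof. by have /polyOverP/(_ i) := P_nneg; rewrite nnegrE. Qed.

Lemma coefPX_ge0 n i : 0 <= (P ^+ n)`_i.
Proof.
elim: n i => [|n IH] i; first by rewrite coef1; case: eqP.
by rewrite exprS coefM_ge0 //; exact: coefP_ge0.
Qed.

Lemma coefP_nat i : P`_i = absz P`_i.
Proof. by rewrite gez0_abs // coefP_ge0. Qed.

(** This is P/P expanded. Natural multiples are used so that the identity can be read inside the
    cone. *)
Lemma sum_gen : \sum_(i < k.+1) gen i *+ absz P`_i = 1.
Proof.
have -> : 1 = P%:F / P%:F :> ratfun by rewrite divff ?PF_neq0.
have -> : P%:F = \sum_(i < k.+1) ('X^i)%:F *+ absz P`_i :> ratfun.
  rewrite -{1}[P]coefK size_P poly_def rmorph_sum /=; apply: eq_bigr => i _.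
  by rewrite {1}coefP_nat -natz scaler_nat rmorphMn.
by rewrite mulr_suml; apply: eq_bigr => i _; rewrite mulrnAl.
Qed.

Lemma RP_pos_gen i : (i <= k)%N -> RP_pos P (gen i).
Proof. by move=> ik; apply: sub_gen_smallest; exists i => //; exact/LogE. Qed.

Lemma RP_pos1 : RP_pos P 1.
Proof.
(* The semiring structure on the cone depends on this lemma, so the sum is followed inside an
   arbitrary closed set [A]. *)
rewrite -sum_gen => A HA; apply: set_mem.
case: (HA) => [[[A0 AD] _] _].
apply: (big_ind (fun x => x \in A)) => // i _.
elim: (absz _) => [|n IH]; rewrite ?mulr0n // mulrS; apply: AD => //.
by apply: mem_set; apply: (RP_pos_gen _ HA); rewrite -ltnS.
Qed.

Lemma RP_pos_semiringClosed :
  exists C : semiringClosed ratfun, forall x, x \in C <-> RP_pos P x.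
Proof. exact: cone_gen_semiringClosed RP_pos1. Qed.

(** In the expansion of 1 given by [sum_gen], the coefficient of [gen i] is at least 1, so one copy
    can be removed and a positive sum remains. *)
Lemma RP_pos_gen_le1 i : (i <= k)%N -> RP_pos P (1 - gen i).
Proof.
move=> ik; have [C CE] := RP_pos_semiringClosed; apply/CE.
rewrite -sum_gen (bigD1 (Ordinal (ik : (i < k.+1)%N))) //= addrAC rpredD //.
  have : (0 < absz (P`_i)%R)%N by rewrite absz_gt0 P_coef.
  case: (absz _) => [//|n] _; rewrite mulrS addrC addKr rpredMn //.
  by apply/CE; exact: RP_pos_gen.
apply: rpred_sum => j _; rewrite rpredMn //; apply/CE; apply: RP_pos_gen.
by rewrite -ltnS.
Qed.

Lemma RP_subringClosed :
  exists V : subringClosed ratfun, forall x, x \in V <-> RP P x.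
Proof. exact: subring_gen_subringClosed. Qed.

Lemma RP_pos_RP f : RP_pos P f -> RP P f.
Proof.
have [V VE] := RP_subringClosed.
move=> fP; elim/cone_gen_ind: f / fP => [x Sx||x y|x y].
- exact: sub_gen_smallest.
- by apply/VE; apply: rpred0.
- by rewrite -!VE; exact: rpredD.
- by rewrite -!VE; exact: rpredM.
Qed.

(** Passing to a common denominator only multiplies numerators by powers of [P], whose coefficients
    are nonnegative. *)
Lemma RP_pos_frac f : RP_pos P f ->
  exists (h : {poly int}) n, (forall i, 0 <= h`_i) /\ f = h%:F / P%:F ^+ n.
Proof.
have PX0 n : P%:F ^+ n != 0 :> ratfun by rewrite expf_neq0 // PF_neq0.
move=> fP; elim/cone_gen_ind: f / fP => [_ [i _ <-]||x y|x y].
- by exists 'X^i, 1%N; split=> [j|]; rewrite ?expr1 // coefXn; case: eqP.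
- by exists 0, 0%N; split=> [j|]; rewrite ?coef0 // tofrac0 mul0r.
- move=> [h [n [hn ->]]] [h' [n' [hn' ->]]].
  exists (h * P ^+ n' + h' * P ^+ n), (n + n')%N; split=> [j|].
    by rewrite coefD addr_ge0 ?coefM_ge0 // => i; exact: coefPX_ge0.
  by rewrite addf_div ?PX0 // tofracD !tofracM !tofracXn exprD.
- move=> [h [n [hn ->]]] [h' [n' [hn' ->]]].
  exists (h * h'), (n + n')%N; split; first exact: coefM_ge0.
  by rewrite mulf_div tofracM exprD.
Qed.

(** * Order ideals of R_P *)

Section OrderIdeal.
Variable I : set ratfun.
Hypothesis idealI : order_ideal P I.

Lemma order_idealB f g : I f -> I g -> I (f - g).
Proof.
have [_ [_ IB] _ _] := idealI => /mem_set If /mem_set Ig; apply: set_mem.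
exact: IB.
Qed.

(** The multipliers that preserve [I] form a subring, so generators suffice. Since 0 <= [gen i] <=
    1, convexity handles positive elements of [I]; by directedness every element of [I] is a
    difference of two of these. *)
Lemma order_idealM f g : RP P g -> I f -> I (g * f).
Proof.
have [V VE] := RP_subringClosed; have [C CE] := RP_pos_semiringClosed.
have [IRP [I0 _] Iconv Idir] := idealI; move: I0 => /set_mem I0.
pose A := [set g | RP P g /\ forall f, I f -> I (g * f)].
suff : RP P `<=` A by move=> RPA /RPA[_]; exact.
apply: smallest_sub => [|_ [i /LogE ik <-]]; last first.
  have gi := RP_pos_gen ik; split; first exact: RP_pos_RP gi.
  have CM x y : RP_pos P x -> RP_pos P y -> RP_pos P (x * y).
    by rewrite -!CE; exact: rpredM.
  have genM x : I x -> RP_pos P x -> I (gen i * x).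
    move=> Ix x0; apply: (Iconv 0 _ x) => //.
    - by apply: RP_pos_RP; exact: CM.
    - by rewrite /RP_le subr0; exact: CM.
    - rewrite /RP_le -[X in X - _]mul1r -mulrBl; apply: CM => //.
      exact: RP_pos_gen_le1.
  move=> x Ix; have [y [Iy xy y0]] := Idir _ _ Ix I0.
  rewrite /RP_le subr0 in y0.
  rewrite (_ : gen i * x = gen i * y - gen i * (y - x)); last first.
    by rewrite -mulrBr opprB addrCA subrr addr0.
  by apply: order_idealB; apply: genM => //; exact: order_idealB.
split=> [|u v /set_mem[Vu Iu] /set_mem[Vv Iv]|
          u v /set_mem[Vu Iu] /set_mem[Vv Iv]]; apply: mem_set; split.
- by apply/VE; apply: rpred1.
- by move=> x Ix; rewrite mul1r.
- by apply/VE; apply: rpredB; exact/VE.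
- by move=> x Ix; rewrite mulrBl; apply: order_idealB; [exact: Iu | exact: Iv].
- by apply/VE; apply: rpredM; exact/VE.
- by move=> x Ix; rewrite -mulrA; apply: Iu; exact: Iv.
Qed.

(** For a nonzero [f] in [I], a common upper bound of [f] and 0 in [I] will do, unless it is 0; then
    [- f] is positive. *)
Lemma order_ideal_pos : I <> [set 0] ->
  exists f, [/\ I f, RP_pos P f & f != 0].
Proof.
have [IRP [I0 _] Iconv Idir] := idealI; move: I0 => /set_mem I0 /eqP Ineq.
have [f [If f0]] : exists f, I f /\ f != 0.
  apply: contrapT => nex; case/eqP: Ineq; apply/seteqP; split=> f /=.
    by move=> If; apply/eqP; apply: contraT => f0; case: nex; exists f.
  by move->.
have [h [Ih fh h0]] := Idir _ _ If I0; rewrite /RP_le subr0 in h0.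
have [hz|hn] := eqVneq h 0; last by exists h.
exists (- f); rewrite oppr_eq0 -sub0r; split=> //; first exact: order_idealB.
by rewrite -hz.
Qed.

End OrderIdeal.

End OrderedRing.

(** * Evaluation at r, and the step from (iv) to (i) *)

Section Evaluation.
Variables (R : realType) (r : R) (P : {poly int}) (k : nat).
Hypotheses (r_gt0 : 0 < r) (size_P : size P = k.+1).
Hypothesis P_nneg : P \is a polyOver Num.nneg.
Hypothesis P_coef : forall i, (i <= k)%N -> P`_i != 0.

Local Notation gen i := (('X^i)%:F / P%:F : ratfun).
Local Notation p := (evalZ r P).

Lemma evalZ_sum n (g : {poly int}) : (size g <= n)%N ->
  evalZ r g = \sum_(i < n) (g`_i)%:~R * r ^+ i.
Proof.
move=> gn; rewrite /evalZ (horner_coef_wide (n := n)).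
  by apply: eq_bigr => i _; rewrite coef_map.
exact: leq_trans (size_poly _ _) gn.
Qed.

Lemma evalZM f g : evalZ r (f * g) = evalZ r f * evalZ r g.
Proof. by rewrite /evalZ rmorphM hornerM. Qed.

Lemma evalZB f g : evalZ r (f - g) = evalZ r f - evalZ r g.
Proof. by rewrite /evalZ rmorphB hornerD hornerN. Qed.

Lemma evalZX f n : evalZ r (f ^+ n) = evalZ r f ^+ n.
Proof. by rewrite /evalZ rmorphXn horner_exp. Qed.

Lemma evalZ1 : evalZ r 1 = 1.
Proof. by rewrite /evalZ rmorph1 hornerC. Qed.

Lemma evalZXn n : evalZ r 'X^n = r ^+ n.
Proof. by rewrite /evalZ map_polyXn hornerXn. Qed.

Lemma evalZP_gt0 : 0 < p.
Proof.
rewrite (@evalZ_sum k.+1) ?size_P // big_ord_recl.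
apply: ltr_wpDr.
  apply: sumr_ge0 => i _; rewrite mulr_ge0 ?exprn_ge0 ?ler0z ?(ltW r_gt0) //.
  exact: coefP_ge0.
by rewrite expr0 mulr1 ltr0z lt_neqAle eq_sym P_coef // (coefP_ge0 P_nneg).
Qed.

Lemma evalZP_neq0 : p != 0. Proof. by rewrite gt_eqF ?evalZP_gt0. Qed.

Let PX0 n : P%:F ^+ n != 0 :> ratfun.
Proof. by rewrite expf_neq0 // (PF_neq0 size_P). Qed.

Let tau_frac g n := tauE g n evalZP_neq0.

Lemma tau1 : tau P r 1 = 1.
Proof.
have := tau_frac 1 0.
by rewrite !expr0 tofrac1 !divr1 evalZ1.
Qed.

Lemma tau_gen i : tau P r (gen i) = r ^+ i / p.
Proof. by have := tau_frac 'X^i 1; rewrite !expr1 evalZXn. Qed.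

Lemma tauB f g : RP P f -> RP P g -> tau P r (f - g) = tau P r f - tau P r g.
Proof.
have P0 := P_neq0 size_P.
move=> /(RP_frac P0)[u [n ->]] /(RP_frac P0)[v [m ->]].
have -> : u%:F / P%:F ^+ n - v%:F / P%:F ^+ m =
    (u * P ^+ m - v * P ^+ n)%:F / P%:F ^+ (n + m) :> ratfun.
  rewrite -mulNr addf_div ?PX0 //.
  by rewrite tofracB !tofracM !tofracXn exprD mulNr.
rewrite !tau_frac evalZB !evalZM !evalZX exprD -[X in _ = _ + X]mulNr.
by rewrite addf_div ?expf_neq0 ?evalZP_neq0 // mulNr.
Qed.

Lemma tauM f g : RP P f -> RP P g -> tau P r (f * g) = tau P r f * tau P r g.
Proof.
have P0 := P_neq0 size_P.
move=> /(RP_frac P0)[u [n ->]] /(RP_frac P0)[v [m ->]].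
by rewrite mulf_div -tofracM -exprD !tau_frac evalZM exprD mulf_div.
Qed.

(** The values of [tau] on R_P form a subring of the reals containing every r^i/P(r). *)
Lemma Rr_tau y : Rr P r y -> exists f, RP P f /\ tau P r f = y.
Proof.
have [V VE] := RP_subringClosed P.
apply: (_ : Rr P r `<=` [set y | exists f, RP P f /\ tau P r f = y]).
apply: smallest_sub => [|_ [i Pi <-]]; last first.
  exists (gen i); rewrite tau_gen; split=> //.
  by apply: sub_gen_smallest; exists i.
split=> [|_ _ /set_mem[f [Vf <-]] /set_mem[g [Vg <-]]|
          _ _ /set_mem[f [Vf <-]] /set_mem[g [Vg <-]]]; apply: mem_set.
- by exists 1; rewrite tau1; split=> //; apply/VE; apply: rpred1.
- exists (f - g); rewrite tauB //; split=> //.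
  by apply/VE; apply: rpredB; apply/VE.
- exists (f * g); rewrite tauM //; split=> //.
  by apply/VE; apply: rpredM; apply/VE.
Qed.

(** Here [m] is a product of generators below [f], and [e] lifts the inverse of its value. For a
    generator this inverse comes from the hypothesis through [Rr_tau]; a sum keeps the [m] of one
    nonzero summand, a product multiplies them. *)
Lemma RP_pos_ge_unit f :
  (forall j, Log P j -> Rr P r (p / r ^+ j)) -> RP_pos P f -> f != 0 ->
  exists m e, [/\ RP_pos P m, RP_pos P (f - m), RP P e & tau P r (e * m) = 1].
Proof.
move=> Hinv.
have [V VE] := RP_subringClosed P.
have [C CE] := RP_pos_semiringClosed size_P P_nneg P_coef.
have CV x : x \in C -> RP P x by move/CE; exact: RP_pos_RP.
suff H : RP_pos P f -> f \in C /\ (f = 0 \/ exists m e,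
    [/\ m \in C, f - m \in C, e \in V & tau P r (e * m) = 1]).
  move=> /H[_ [-> /eqP//|[m [e [mC fm eV em]]]] _].
  by exists m, e; split; [exact/CE | exact/CE | exact/VE |].
move=> fP; elim/cone_gen_ind: f / fP => [_ [j Pj <-]||x y|x y].
- have gC : gen j \in C by apply/CE; apply: sub_gen_smallest; exists j.
  split=> //; right; have [e [eV te]] := Rr_tau (Hinv _ Pj).
  exists (gen j), e; split=> //; first by rewrite subrr rpred0.
    exact/VE.
  rewrite tauM //; last exact: CV.
  rewrite te tau_gen mulf_div [p * _]mulrC divff // mulf_neq0 ?evalZP_neq0 //.
  by rewrite expf_neq0 ?gt_eqF.
- by split; [exact: rpred0 | left].
- move=> [xC Hx] [yC Hy]; split; first exact: rpredD.
  case: Hx => [->|[m [e [mC xm eV em]]]]; first by rewrite add0r.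
  by right; exists m, e; split=> //; rewrite addrAC rpredD.
- move=> [xC Hx] [yC Hy]; split; first exact: rpredM.
  case: Hx => [->|[m [e [mC xm eV em]]]]; first by left; rewrite mul0r.
  case: Hy => [->|[m' [e' [mC' ym eV' em']]]]; first by left; rewrite mulr0.
  right; exists (m * m'), (e * e'); split; try exact: rpredM.
    have -> : x * y - m * m' = (x - m) * y + m * (y - m').
      by rewrite mulrBl mulrBr addrA subrK.
    by rewrite rpredD ?rpredM.
  have EV u v : u \in V -> v \in C -> RP P (u * v).
    by move=> uV vC; apply/VE; apply: rpredM => //; apply/VE; exact: CV.
  by rewrite mulrACA tauM ?em ?em' ?mulr1 //; exact: EV.
Qed.

(** [I] contains [e * m], of value 1, so every value [tau P r g] is also taken at [g * (e * m)],
    which lies in [I]. *)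
Lemma image_tau_order_ideal (I : set ratfun) :
  (forall j, Log P j -> Rr P r (p / r ^+ j)) ->
  order_ideal P I -> I <> [set 0] -> tau P r @` I = tau P r @` RP P.
Proof.
move=> Hinv idealI In0; have [IRP [/set_mem I0 _] Iconv _] := idealI.
have [f [If fpos f0]] := order_ideal_pos idealI In0.
have [m [e [mpos fm eV em]]] := RP_pos_ge_unit Hinv fpos f0.
have Im : I m.
  by apply: (Iconv 0 m f) => //; [exact: RP_pos_RP | rewrite /RP_le subr0].
apply/seteqP; split=> [_ [g Ig <-]|_ [g Vg <-]].
  by exists g => //; exact: IRP.
have Iem : I (e * m) by exact: (order_idealM size_P).
exists (g * (e * m)); first exact: (order_idealM size_P).
by rewrite tauM ?em ?mulr1 //; exact: IRP.
Qed.

(** * The order ideal generated by x^j/P, and the relation for r that it yields *)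

Definition gen_ideal j : set ratfun :=
  [set f | RP P f /\ exists N, RP_pos P (gen j *+ N - f) /\
                               RP_pos P (gen j *+ N + f)].

Lemma gen_ideal_order_ideal j : (j <= k)%N -> order_ideal P (gen_ideal j).
Proof.
move=> jk.
have [V VE] := RP_subringClosed P.
have [C CE] := RP_pos_semiringClosed size_P P_nneg P_coef.
have gC N : gen j *+ N \in C.
  by rewrite rpredMn //; apply/CE; exact: (RP_pos_gen size_P P_coef).
have idealE f : gen_ideal j f <->
    f \in V /\ exists N, gen j *+ N - f \in C /\ gen j *+ N + f \in C.
  by split=> -[fV [N [/CE fm /CE fp]]]; (split; first exact/VE); exists N.
split.
- by move=> f [].
- split; first by apply/mem_set/idealE; split; [exact: rpred0|];
    exists 0%N; rewrite addr0 subr0 mulr0n rpred0.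
  move=> f g /set_mem/idealE[fV [N [fm fp]]] /set_mem/idealE[gV [M [gm gp]]].
  apply/mem_set/idealE; split; first exact: rpredB.
  exists (N + M)%N; rewrite mulrnDr opprB; split.
    by rewrite [g - f]addrC addrACA rpredD.
  by rewrite addrACA rpredD.
- move=> f g h /idealE[_ [N [_ fp]]] /idealE[_ [M [hm _]]] gV /CE fg /CE gh.
  apply/idealE; split; first exact/VE; exists (N + M)%N; rewrite mulrnDr; split.
    have -> : gen j *+ N + gen j *+ M - g =
      gen j *+ N + ((gen j *+ M - h) + (h - g)) by rewrite subrKA addrA.
    by rewrite rpredD // rpredD.
  have -> : gen j *+ N + gen j *+ M + g =
      gen j *+ M + (gen j *+ N + f) + (g - f).
    rewrite (addrA (gen j *+ M)) [RHS]addrACA subrr addr0.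
    by rewrite (addrC (gen j *+ N)).
  by rewrite rpredD // rpredD.
- move=> f g /idealE[_ [N [fm _]]] /idealE[_ [M [gm _]]].
  (* The two multiples bound [f] and [g] respectively and are both positive, so their sum bounds
     both. *)
  exists (gen j *+ N + gen j *+ M); split.
  + apply/idealE; split.
      by apply/VE; apply: RP_pos_RP; apply/CE; apply: rpredD.
    by exists (N + M)%N; rewrite mulrnDr subrr rpred0 !rpredD.
  + by apply/CE; rewrite addrAC rpredD.
  + by apply/CE; rewrite -addrA rpredD.
Qed.

Lemma gen_ideal_neq0 j : (j <= k)%N -> gen_ideal j <> [set 0].
Proof.
move=> jk; have [C CE] := RP_pos_semiringClosed size_P P_nneg P_coef.
have gj := RP_pos_gen size_P P_coef jk.
have gj0 : gen j != 0.
  apply: mulf_neq0; last by rewrite invr_eq0 (PF_neq0 size_P).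
  by rewrite tofrac_eq0 -size_poly_eq0 size_polyXn.
suff : gen_ideal j (gen j).
  by move=> + I0; rewrite I0 => gj_eq0; case/eqP: gj0.
split; first exact: RP_pos_RP; exists 1%N; rewrite mulr1n subrr.
by split; apply/CE; [exact: rpred0 | apply: rpredD; exact/CE].
Qed.

(* An element f of the ideal generated by x^j / P is g / P^(n+1) where g
   involves only monomials of x^j P^n, because P^(n+1) (N x^j / P - f) and
   P^(n+1) (N x^j / P + f) have no negative coefficients. *)
Lemma gen_ideal_frac j f : gen_ideal j f ->
  exists (g : {poly int}) n, f = g%:F / P%:F ^+ n.+1 /\
    forall i, ('X^j * P ^+ n)`_i = 0 -> g`_i = 0.
Proof.
move=> [_ [N [/(RP_pos_frac size_P P_nneg)[h [n [h0 fm]]]]]].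
move=> /(RP_pos_frac size_P P_nneg)[h' [m [h'0 fp]]].
pose W := 'X^j * P ^+ (n + m).
pose H := h * P ^+ m.+1; pose H' := h' * P ^+ n.+1.
have cancel u a b : u%:F / P%:F ^+ a = (u * P ^+ b)%:F / P%:F ^+ (a + b).
  by rewrite tofracM tofracXn exprD -mulf_div divff ?mulr1.
have genW : gen j = W%:F / P%:F ^+ (n + m).+1.
  by rewrite -[(n + m).+1]add1n -cancel expr1.
rewrite (cancel _ n m.+1) addnS -/H in fm.
rewrite (cancel _ m n.+1) addnS (addnC m) -/H' in fp.
(* [f] cancels when the two bounds are added. Where a coefficient of [W] is 0, the nonnegative
   coefficients of [H] and [H'] therefore add up to 0, and both vanish. *)
have HH' : H + H' = W *+ N + W *+ N.
  apply/eqP; rewrite -tofrac_eq; apply/eqP/(mulIf (invr_neq0 (PX0 (n + m).+1))).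
  rewrite !tofracD !tofracMn !mulrDl -fm -fp genW -!mulrnAl addrACA.
  by rewrite addNr addr0.
exists (H' - W *+ N), (n + m)%N; split.
  rewrite tofracB mulrBl -fp tofracMn genW mulrnAl addrC.
  by rewrite addKr.
move=> i Wi; have /(congr1 (fun u : {poly int} => u`_i)) := HH'.
rewrite !coefD !coefMn Wi !mul0rn addr0 => /eqP.
rewrite paddr_eq0; last 2 first.
- by apply: coefM_ge0 => // l; exact: (coefPX_ge0 P_nneg).
- by apply: coefM_ge0 => // l; exact: (coefPX_ge0 P_nneg).
by move=> /andP[_ /eqP ->]; rewrite coefN coefMn Wi mul0rn subrr.
Qed.

(** Some [f] = g/P^(n+1) in the ideal has value 1, so P^(n+1) - g vanishes at r, and g alters only
    coefficients at monomials of x^j P^n. Taking j = 0 leaves the leading coefficient intact, j = k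
    the constant one. *)
Lemma relation_of_gen_ideal j : (j <= k)%N ->
  (forall I : set ratfun, order_ideal P I -> I <> [set 0] ->
     tau P r @` I = tau P r @` RP P) ->
  exists n (b : nat -> int),
    \sum_(i < (k * n.+1).+1) (b i)%:~R * r ^+ i = 0 /\
    forall i, ('X^j * P ^+ n)`_i = 0 -> b i = (P ^+ n.+1)`_i.
Proof.
move=> jk HI; have := HI _ (gen_ideal_order_ideal jk) (gen_ideal_neq0 jk).
have [V VE] := RP_subringClosed P.
move=> /seteqP[_ /(_ 1)[|f If]].
  by exists 1; [apply/VE; exact: rpred1 | exact: tau1].
have [g [n [-> gW]]] := gen_ideal_frac If; rewrite tau_frac => pg.
have evg : evalZ r g = p ^+ n.+1.
  by rewrite -[RHS]mul1r -pg divfK // expf_neq0 // evalZP_neq0.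
exists n, (fun i => (P ^+ n.+1 - g)`_i); split; last first.
  by move=> i Wi; rewrite coefB gW // subr0.
rewrite -evalZ_sum ?evalZB ?evalZX ?evg ?subrr //.
rewrite (leq_trans (size_polyD _ _)) // geq_max (size_PX size_P) leqnn.
rewrite size_polyN /=.
(* Since j <= k, x^j P^n has degree at most k (n + 1), and g inherits this bound. *)
apply/leq_sizeP => i ki; apply: gW; apply/leq_sizeP/ki.
rewrite mulrC size_mulXn ?expf_neq0 ?(P_neq0 size_P) // (size_PX size_P).
by rewrite addnS ltnS mulnS leq_add2r.
Qed.

End Evaluation.

(** * The cycle of implications *)

Lemma exprV_sub (K : fieldType) (x : K) i n : x != 0 -> (i <= n)%N ->
  x^-1 ^+ (n - i) = x ^+ i / x ^+ n.
Proof.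
move=> x0 ni; rewrite exprVn -{2}(subnK ni) exprD invfM mulrCA divff ?mulr1 //.
by rewrite expf_neq0.
Qed.

Theorem proposition3p4 (R : realType) (r : R) (P : {poly int}) (k : nat)
    (r_gt0 : 0 < r) (k_ge1 : (1 <= k)%N) (size_P : size P = k.+1)
    (P_nneg : P \is a polyOver Num.nneg)
    (P_coef : forall i, (i <= k)%N -> P`_i != 0) :
  [<-> (forall I : set ratfun, order_ideal P I -> I <> [set 0] ->
          tau P r @` I = tau P r @` RP P);
       (exists s t : nat,
          algebraic_integer ((P`_k)%:~R ^+ s * r) /\
          algebraic_integer ((P`_0)%:~R ^+ t / r));
       Rr P r = subring_gen [set r; r^-1; evalZ r P; (evalZ r P)^-1];
       (forall j, Log P j -> Rr P r (evalZ r P / r ^+ j))].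
Proof.
have P0 := P_neq0 size_P.
have r0 : r != 0 by rewrite gt_eqF.
have p0 := evalZP_neq0 r_gt0 size_P P_nneg P_coef.
have [V VE] := subring_gen_subringClosed [set r ^+ i / evalZ r P | i in Log P].
have [W WE] := subring_gen_subringClosed
  [set r; r^-1; evalZ r P; (evalZ r P)^-1].
have uV i : (i <= k)%N -> r ^+ i / evalZ r P \in V.
  move=> ik; apply/VE; apply: sub_gen_smallest; exists i => //.
  exact/(LogE size_P P_coef).
have p_sum := evalZ_sum r (eq_leq size_P).
tfae.
- move=> HI; have rel := relation_of_gen_ideal r_gt0 size_P P_nneg P_coef.
  have [n [b [b_rel b_coef]]] := rel _ (leq0n k) HI.
  have [m [c [c_rel c_coef]]] := rel _ (leqnn k) HI.
  exists n.+1, m.+1; split.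
    (* With j = 0, P^n has degree k n < k (n + 1), so the top coefficient of the relation is that of
       P^(n+1). *)
    rewrite (_ : (P`_k)%:~R ^+ n.+1 = (b (k * n.+1)%N)%:~R).
      exact: integral_lead_coef b_rel.
    rewrite b_coef; last first.
      by rewrite nth_default // expr0 mul1r (size_PX size_P) ltn_pmul2l.
    have := lead_coef_exp P n.+1.
    by rewrite !lead_coefE (size_PX size_P) size_P /= => ->; rewrite rmorphXn.
  (* Reversing the coefficients turns the relation for r into one for 1/r with leading coefficient
     [c 0], written here with the reversed index. As x^k P^m has no constant term, [c 0] is the
     constant coefficient of P^(m+1). *)
  rewrite (_ : (P`_0)%:~R ^+ m.+1 = (c (k * m.+1 - k * m.+1)%N)%:~R).
    apply: (@integral_lead_coef _ (fun i => c (k * m.+1 - i)%N)).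
    have rN : r ^+ (k * m.+1) != 0 by rewrite expf_neq0.
    apply: (mulIf rN); rewrite mul0r -[RHS]c_rel mulr_suml.
    rewrite (reindex_inj rev_ord_inj) /=; apply: eq_bigr => i _.
    have iN : (i <= k * m.+1)%N by rewrite -ltnS.
    rewrite subSS subKn // -mulrA; congr (_ * _).
    by rewrite exprV_sub // divfK.
  rewrite subnn c_coef; last by rewrite coefXnM k_ge1.
  by rewrite -!horner_coef0 horner_exp rmorphXn.
- move=> [s [t [kr_int r0_int]]].
  have pV : evalZ r P \in V.
    exact: (integral_inv_mem (a := fun i => P`_i) k_ge1 p0 p_sum uV kr_int).
  have rV_exp i : (i <= k)%N -> r ^+ (k - i) / r ^+ k = r^-1 ^+ i.
    by move=> ik; rewrite -exprV_sub ?leq_subr // subKn.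
  (* Same criterion for the reversed polynomial at 1/r, whose value is P(r)/r^k; its quotients
     r^-i/(P(r)/r^k) are the r^(k-i)/P(r) again. *)
  have pkV : evalZ r P / r ^+ k \in V.
    apply: (@integral_inv_mem _ V (fun i => P`_(k - i)) r^-1 _ k t k_ge1).
    + by rewrite mulf_neq0 ?invr_neq0 ?expf_neq0.
    + rewrite p_sum mulr_suml (reindex_inj rev_ord_inj) /=.
      apply: eq_bigr => i _; have ik : (i <= k)%N by rewrite -ltnS.
      rewrite subSS -mulrA; congr (_ * _).
      exact: rV_exp.
    + move=> i ik; have := uV _ (leq_subr i k); congr (_ \in V).
      by rewrite -rV_exp // invfM invrK mulrACA mulVf ?mulr1 // expf_neq0.
    + by rewrite subnn.
  (* Here k >= 1 is used: r/P(r), and below r^(k-1)/P(r), are generators, to be multiplied by P(r)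
     and P(r)/r^k. *)
  have rV : r \in V.
    rewrite (_ : r = r ^+ 1 / evalZ r P * evalZ r P); last by rewrite divfK.
    by rewrite rpredM ?uV.
  have rVV : r^-1 \in V.
    rewrite (_ : r^-1 = evalZ r P / r ^+ k * (r ^+ k.-1 / evalZ r P)).
      by rewrite rpredM ?uV ?leq_pred.
    rewrite mulrC mulrA divfK // -{2}(prednK k_ge1) exprS invfM mulrCA mulfV.
      by rewrite mulr1.
    by rewrite expf_neq0.
  apply/seteqP; split=> y.
    move=> Ry; apply/WE; move: y Ry; apply: subring_gen_ind => _ [i _ <-].
    by rewrite rpredM ?rpredX //; apply/WE; apply: sub_gen_smallest;
      [left; left; left | right].
  move=> Wy; apply/VE; move: y Wy; apply: subring_gen_ind.
  move=> _ [[[->|->]|->]|->] //.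
  by have := uV _ (leq0n k); rewrite mul1r.
- move=> -> j _; apply/WE.
  rewrite -exprVn rpredM ?rpredX //; apply/WE; apply: sub_gen_smallest.
    by left; right.
  by left; left; right.
- by move=> Hinv I; exact: (image_tau_order_ideal r_gt0 size_P P_nneg P_coef).
Qed.
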